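(* Let $(T_1,T_2)$ be a pair of commuting pure partial isometries on a Hilbert space $\mathcal{H}$. Then $(T_1,T_2)$ always dilates to a pair of commuting pure isometries.
   Context: All Hilbert spaces are complex. A partial isometry is a bounded operator that is isometric on the orthogonal complement of its kernel. A contraction $T$ on $\mathcal{H}$ is pure if $\|T^{*m}h\|\to0$ as $m\to\infty$ for every $h\in\mathcal{H}$. A pair of commuting pure partial isometries (isometries) is a commuting pair in which each of the two operators is a partial isometry (isometry) and is pure. $(T_1,T_2)$ on $\mathcal{H}$ dilates to a pair $(V_1,V_2)$ on a Hilbert space $\mathcal{K}$ if there is an isometry $\Pi:\mathcal{H}\to\mathcal{K}$ with $\Pi T_i^*=V_i^*\Pi$ for $i=1,2$. *)

(* Defs.v *)
From HB Require Import structures.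
From mathcomp Require Import all_boot all_order all_algebra sesquilinear.
From mathcomp Require Import complex.
From mathcomp Require Import boolp classical_sets functions reals topology.
From mathcomp Require Import normedtype sequences ring lra.

Set Implicit Arguments.
Unset Strict Implicit.
Unset Printing Implicit Defensive.

Import Order.TTheory GRing.Theory Num.Theory.
Import numFieldNormedType.Exports.

Local Open Scope classical_set_scope.
Local Open Scope ring_scope.
Local Open Scope complex_scope.

(* The inner product is linear in its first argument and conjugate-linear in
   its second one, as {dot _ for _} prescribes. *)
HB.mixin Record CompleteNormedModule_isHilbert (R : realType) H
    of CompleteNormedModule R[i] H := {
  hdot : {dot H for (@Num.conj R[i])} ;
  hdot_norm : forall x : H, hdot x x = `|x| ^+ 2
}.

#[short(type="hilbertType")]
HB.structure Definition Hilbert (R : realType) :=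
  {H of CompleteNormedModule R[i] H & CompleteNormedModule_isHilbert R H}.

Arguments hdot {R s}.

Notation "''[' x , y ]" := (hdot x%R y%R)
  (format "''[' x ,  y ]") : ring_scope.

Section Riesz.
Variables (R : realType).
Implicit Types H : hilbertType R.

Lemma hdotC H (x y : H) : '[x, y] = ('[y, x]^*)%R.
Proof. by rewrite hermitian_subproof expr0 mul1r. Qed.

Lemma normB_proj H (x y : H) : y != 0 ->
  `|x - ('[x, y] / '[y, y]) *: y| ^+ 2 = `|x| ^+ 2 - `|'[x, y]| ^+ 2 / `|y| ^+ 2.
Proof.
move=> y0; rewrite -!hdot_norm.
have c0 : '[y, y] != 0 by rewrite hdot_norm expf_eq0 normr_eq0 (negPf y0).
have cr : ('[y, y]^*)%R = '[y, y] by rewrite -hdotC.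
rewrite linearBl linearBr linearZl_LR /= linearBr linearZr_LR linearZr_LR /=.
rewrite (hdotC y x) normCK [((_ / _)^*)%R]rmorphM fmorphV /= cr.
by field.
Qed.

Lemma hdot_CauchySchwarz H (x y : H) : `|'[x, y]| <= `|x| * `|y|.
Proof.
have [->|y0] := eqVneq y 0; first by rewrite linear0r normr0 normr0 mulr0.
have := exprn_ge0 2 (normr_ge0 (x - ('[x, y] / '[y, y]) *: y)).
rewrite normB_proj// subr_ge0 ler_pdivrMr ?exprn_gt0 ?normr_gt0//.
by rewrite -exprMn ler_pXn2r ?nnegrE ?mulr_ge0.
Qed.

Lemma parallelogram H (x y : H) :
  `|x - y| ^+ 2 = `|x| ^+ 2 *+ 2 + `|y| ^+ 2 *+ 2 - `|x + y| ^+ 2.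
Proof.
rewrite -!hdot_norm linearBl linearDl /= !linearBr !linearDr /=.
by ring.
Qed.

Lemma Riesz H (f : H -> R[i]) (M : R[i]) :
  (forall a x y, f (a *: x + y) = a * f x + f y) ->
  (forall x, `|f x| <= M * `|x|) ->
  exists z, forall x, f x = '[x, z].
Proof.
move=> flin fM.
have f0 : f 0 = 0.
  by apply/eqP; have := fM 0; rewrite normr0 mulr0 normr_le0.
have fD x y : f (x + y) = f x + f y by rewrite -[x]scale1r flin mul1r scale1r.
have fZ a x : f (a *: x) = a * f x by rewrite -[a *: x]addr0 flin f0 addr0.
have fB x y : f (x - y) = f x - f y by rewrite fD -scaleN1r fZ mulN1r.
have [[x1 fx1]|fz] := pselect (exists x, f x != 0); last first.
  exists 0 => x; rewrite linear0r; apply/eqP/negPn/negP => fx.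
  by apply: fz; exists x.
pose N (x : H) : R := complex.Re `|x|.
have NE x : `|x| = (N x)%:C.
  by rewrite /N; have := normr_ge0 x; case: (`|x|) => a b; rewrite lecE /= => /andP[/eqP -> _].
have N0 x : 0 <= N x by rewrite -lecR -NE; exact: normr_ge0.
have NB x y : N x <= N y + N (x - y).
  by rewrite -lecR rmorphD /= -!NE -{1}(subrKC y x) ler_normD.
have Npar x y : N (x - y) ^+ 2 = N x ^+ 2 *+ 2 + N y ^+ 2 *+ 2 - N (x + y) ^+ 2.
  apply: complexI; rewrite rmorphB rmorphD /= !rmorphMn /= !rmorphXn /= -!NE.
  exact: parallelogram.
pose A := [set x | f x = 1].
have AA x y : A x -> A y -> A (2^-1 *: (x + y)).
  by rewrite /A /= fZ fD => -> ->; rewrite mulVf// pnatr_eq0.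
pose d := inf (N @` A).
have A1 : A ((f x1)^-1 *: x1) by rewrite /A /= fZ mulVf.
have hinf : has_inf (N @` A).
  by split; [exists (N ((f x1)^-1 *: x1)), ((f x1)^-1 *: x1) | exists 0 => _ [x _ <-]].
have dN x : A x -> d <= N x.
  by move=> Ax; apply: ge_inf; [exact: hinf.2 | exists x].
have d0 : 0 <= d by apply: lb_le_inf; [exact: hinf.1 | move=> _ [x _ <-]; exact: N0].
have dN2 x y : A x -> A y -> d *+ 2 <= N (x + y).
  move=> Ax Ay; have := dN _ (AA _ _ Ax Ay).
  rewrite -lecR -NE normrZ normfV normr_nat NE => h.
  have : 2 * d%:C <= (N (x + y))%:C.
    by rewrite mulrC -ler_pdivlMr ?ltr0n// mulrC.
  by rewrite mulr_natl -rmorphMn /= lecR.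
pose B e := [set x | A x /\ N x < d + e].
pose F := filter_from [set e : R | 0 < e] B.
have FF : ProperFilter F.
  apply: filter_from_proper; last first.
    move=> e /= e0; have [_ [x Ax <-] xe] := inf_adherent e0 hinf.
    by exists x.
  apply: filter_from_filter; first by exists 1 => /=.
  move=> e e' /= e0 e'0; exists (Num.min e e'); first by rewrite /= lt_min e0.
  by move=> x [Ax]; rewrite -ltrBlDl lt_min => /andP[? ?]; split; split=> //; rewrite -ltrBlDl.
have Fcvg : cvg F.
  apply: cauchy_cvg; apply: cauchy_exP => eps eps0.
  have epsE : eps = (complex.Re eps)%:C.
    by move: eps0; case: eps => a b; rewrite ltcE /= => /andP[/eqP -> _].
  have e0 : 0 < complex.Re eps by move: eps0; rewrite {1}epsE ltcR.
  set E := complex.Re eps in epsE e0.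
  pose e := Num.min 1 (E ^+ 2 / (8 * d + 8)).
  have ep : 0 < e by rewrite /e lt_min ltr01 divr_gt0 ?exprn_gt0//; lra.
  have e1 : e <= 1 by rewrite /e ge_min lexx.
  have e2 : e * (8 * d + 8) <= E ^+ 2.
    by rewrite -ler_pdivlMr; [rewrite /e ge_min lexx orbT | lra].
  have [_ [x Ax <-] xe] := inf_adherent ep hinf.
  exists x; exists e => // y [Ay ye].
  rewrite -ball_normE /= NE epsE ltcR -(ltr_pXn2r (n:=2)) ?nnegrE ?(ltW e0)//.
  rewrite Npar.
  have := dN _ Ax; have := dN _ Ay; have := dN2 _ _ Ax Ay.
  rewrite -/d in xe *; nra.
have [x0 Fx0] := (cvg_ex F).1 Fcvg.
have app e : 0 < e -> exists x, [/\ A x, N x < d + e & N (x0 - x) < e].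
  move=> e0.
  have h1 : F (B e) by exists e.
  have h2 : F (ball x0 e%:C) by apply: Fx0; apply: nbhsx_ballx; rewrite ltcR.
  have [x [[Ax xe] xb]] := filter_ex (filterI h1 h2).
  by exists x; split=> //; move: xb; rewrite -ball_normE /= NE ltcR.
have Ax0 : A x0.
  apply/eqP; rewrite -subr_eq0 -normr_le0; apply/ler_addgt0Pl => eps eps0.
  rewrite addr0.
  have [M0|M0] := eqVneq M 0.
    have [x [Ax _ _]] := app _ ltr01.
    have := fM (x0 - x); rewrite M0 mul0r fB Ax => h; exact: (le_trans h (ltW eps0)).
  have Mp : 0 < M.
    have: 0 <= M * `|x1| by apply: le_trans (fM x1).
    have x1p : 0 < `|x1| by rewrite normr_gt0; apply: contraNneq fx1 => ->; rewrite f0.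
    by rewrite pmulr_lge0// lt_def M0.
  have q0 : 0 < eps / M by rewrite divr_gt0.
  have qE : eps / M = (complex.Re (eps / M))%:C.
    by move: q0; case: (eps / M) => a b; rewrite ltcE /= => /andP[/eqP -> _].
  have [|x [Ax _ xb]] := app (complex.Re (eps / M)).
    by rewrite -ltcR -qE.
  have := fM (x0 - x); rewrite fB Ax => /le_trans; apply.
  by rewrite mulrC -ler_pdivlMr// qE NE lecR ltW.
have x0d : N x0 <= d.
  apply/ler_addgt0Pl => e e0.
  have [|x [Ax xe xb]] := app (e / 2); first lra.
  have := NB x0 x; lra.
have x0n : x0 != 0.
  by apply: contra_eq_neq Ax0 => ->; rewrite f0 eq_sym oner_neq0.
have ort k : f k = 0 -> '[x0, k] = 0.
  move=> fk; have [->|k0] := eqVneq k 0; first by rewrite linear0r.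
  have : N x0 <= N (x0 - ('[x0, k] / '[k, k]) *: k).
    by apply: le_trans x0d _; apply: dN; rewrite /A /= fB fZ fk mulr0 subr0.
  rewrite -lecR -!NE -(ler_pXn2r (n:=2)) ?nnegrE// normB_proj//.
  rewrite lerBrDl gerDr pmulr_lle0 ?invr_gt0 ?exprn_gt0 ?normr_gt0//.
  move=> h; apply/eqP; rewrite -normr_eq0 -sqrf_eq0 eq_le h.
  by rewrite exprn_ge0.
exists (('[x0, x0])^-1 *: x0) => x.
have c0 : '[x0, x0] != 0 by rewrite hdot_norm expf_eq0 normr_eq0 (negPf x0n).
have : '[x0, x - f x *: x0] = 0.
  by apply: ort; rewrite fB fZ Ax0 mulr1 subrr.
rewrite hdotC => /(congr1 Num.conj); rewrite conjCK rmorph0 linearBl linearZl_LR.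
move=> /eqP; rewrite subr_eq0 => /eqP h.
have cr : ('[x0, x0]^*)%R = '[x0, x0] by rewrite -hdotC.
rewrite linearZr_LR /= h fmorphV /= cr.
by rewrite mulrCA mulVf// mulr1.
Qed.

End Riesz.

Section Operators.
Variable R : realType.

Definition bounded_operator (H K : hilbertType R) (T : {linear H -> K}) :=
  exists M : R[i], forall x, `|T x| <= M * `|x|.

(* adjoint T y, usually written T^* y, is the vector z such that '[T x, y] =
   '[x, z] for every x; for a bounded T it exists and is unique, see adjointP
   and adjoint_uniq. *)
Definition adjoint (H K : hilbertType R) (T : {linear H -> K}) (y : K) : H :=
  xget 0 [set z : H | forall x, '[T x, y] = '[x, z]].

Lemma adjointP (H K : hilbertType R) (T : {linear H -> K}) : bounded_operator T ->
  forall x y, '[T x, y] = '[x, adjoint T y].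
Proof.
move=> [M TM] x y; rewrite /adjoint; case: xgetP => [z _ ->//|].
move=> /(_ _) nz; exfalso.
have [|x' |z zP] := @Riesz R H (fun x => '[T x, y]) (M * `|y|).
- by move=> a u v; rewrite linearP linearPl.
- apply: le_trans (hdot_CauchySchwarz _ _) _.
  by rewrite mulrAC ler_wpM2r.
- exact: (nz z).
Qed.

Lemma adjoint_uniq (H K : hilbertType R) (T : {linear H -> K}) y z :
  (forall x, '[T x, y] = '[x, z]) -> adjoint T y = z.
Proof.
move=> zP; rewrite /adjoint; case: xgetP => [z' _ z'P|/(_ z)//].
apply/eqP; rewrite -subr_eq0 -normr_eq0 -sqrf_eq0 -hdot_norm linearBr /=.
by rewrite -z'P -zP subrr.
Qed.

Definition contractive (H K : hilbertType R) (T : {linear H -> K}) :=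
  forall x, `|T x| <= `|x|.

Definition isometric (H K : hilbertType R) (T : {linear H -> K}) :=
  forall x, `|T x| = `|x|.

Definition partial_isometry (H K : hilbertType R) (T : {linear H -> K}) :=
  bounded_operator T /\
  forall x, (forall k, T k = 0 -> '[x, k] = 0) -> `|T x| = `|x|.

(* The complex norms converge in R[i], seen as a normed space over itself. *)
Definition pure_contraction (H : hilbertType R) (T : {linear H -> H}) :=
  contractive T /\
  forall h, (`|iter m (adjoint T) h| : R[i]^o) @[m --> \oo] --> (0 : R[i]^o).

Definition commuting (H : hilbertType R) (T1 T2 : {linear H -> H}) :=
  forall x, T1 (T2 x) = T2 (T1 x).

Definition commuting_pure_partial_isometries (H : hilbertType R)
    (T1 T2 : {linear H -> H}) :=
  [/\ commuting T1 T2, partial_isometry T1, partial_isometry T2,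
      pure_contraction T1 & pure_contraction T2].

Definition commuting_pure_isometries (H : hilbertType R)
    (V1 V2 : {linear H -> H}) :=
  [/\ commuting V1 V2, isometric V1, isometric V2,
      pure_contraction V1 & pure_contraction V2].

Definition dilates_to (H K : hilbertType R)
    (T1 T2 : {linear H -> H}) (V1 V2 : {linear K -> K}) :=
  exists P : {linear H -> K}, [/\ isometric P,
    forall h, P (adjoint T1 h) = adjoint V1 (P h) &
    forall h, P (adjoint T2 h) = adjoint V2 (P h)].

End Operators.

(* Main.v *)
(* Let D_i = 1 - T_i T_i^*, the projection onto ker T_i^*.  Ando's vectors
   (D1 h, D2 T1^* h) and (D1 T2^* h, D2 h) have equal norms; the reflection in
   the closed span of their sums exchanges them, and provides an explicit
   unitary U extending Ando's partial isometry, hence a dilation of (T1, T2) to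
   a Berger-Coburn-Lebow pair V1 = U ((1 - P) + z P), V2 = (P + z (1 - P)) U^*
   on H^2(E).  Such a pair is pure as soon as the compressions of U to P E and of
   U^* to (1 - P) E are strongly stable.  This is where partial isometries enter:
   D1 and D2 are projections, ker T1^* is invariant under T2^* and ker T2^* under
   T1^*, so that the compressions are built from the restrictions of T2^* to
   ker T1^* and of T1^* to ker T2^*, whose powers tend strongly to 0. *)
From HB Require Import structures.
Require Import Defs.
From mathcomp Require Import all_boot all_order all_algebra sesquilinear.
From mathcomp Require Import complex.
From mathcomp Require Import boolp classical_sets functions reals topology.
From mathcomp Require Import normedtype sequences ring lra.

Set Implicit Arguments.
Unset Strict Implicit.
Unset Printing Implicit Defensive.

Import Order.TTheory GRing.Theory Num.Theory.
Import numFieldNormedType.Exports.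

Local Open Scope classical_set_scope.
Local Open Scope ring_scope.
Local Open Scope complex_scope.

(** * Real inner product and squared norm *)

Section RealDot.
Variable R : realType.
Implicit Types H K : hilbertType R.

(** Estimates and limits are carried out in the ordered field [R]; [hdot_rdot] recovers the complex
    inner product afterwards. *)
Definition rdot H (x y : H) : R := complex.Re '[x, y].
Definition sqn H (x : H) : R := rdot x x.

Lemma hdot_sqn H (x : H) : '[x, x] = (sqn x)%:C.
Proof.
rewrite /sqn /rdot hdot_norm; have := exprn_ge0 2 (normr_ge0 x).
by case: (_ ^+ 2) => a b; rewrite lecE /= => /andP[/eqP -> _].
Qed.

Lemma sqn_ge0 H (x : H) : 0 <= sqn x.
Proof. by rewrite -lecR -hdot_sqn hdot_norm exprn_ge0. Qed.

Lemma norm_sqn H (x : H) : `|x| = (Num.sqrt (sqn x))%:C.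
Proof.
apply/eqP; rewrite -(eqrXn2 (n := 2))// ?lecR ?sqrtr_ge0//.
by rewrite -hdot_norm hdot_sqn -rmorphXn /= sqr_sqrtr ?sqn_ge0.
Qed.

Lemma sqn_eq0 H (x : H) : sqn x = 0 -> x = 0.
Proof. by move=> x0; apply/eqP; rewrite -normr_eq0 norm_sqn x0 sqrtr0. Qed.

Lemma sqn0 H : sqn (0 : H) = 0.
Proof. by rewrite /sqn /rdot linear0r. Qed.

Lemma le_sqn H K (x : H) (y : K) : (`|x| <= `|y|) = (sqn x <= sqn y).
Proof. by rewrite !norm_sqn lecR ler_sqrt // sqn_ge0. Qed.

Lemma sqnZ H a (x : H) : sqn (a *: x) = complex.Re (a * a^*) * sqn x.
Proof.
apply: complexI; rewrite -hdot_sqn linearZl_LR linearZr_LR /= mulrA hdot_sqn.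
rewrite rmorphM /= -normCK; congr (_ * _).
have := exprn_ge0 2 (normr_ge0 a).
by case: (_ ^+ 2) => p q; rewrite lecE /= => /andP[/eqP -> _].
Qed.

Lemma rdotC H (x y : H) : rdot x y = rdot y x.
Proof. by rewrite /rdot hdotC; case: '[y, x]. Qed.

Lemma rdotDl H (x y z : H) : rdot (x + y) z = rdot x z + rdot y z.
Proof. by rewrite /rdot linearDl raddfD. Qed.

Lemma rdotNl H (x z : H) : rdot (- x) z = - rdot x z.
Proof. by rewrite /rdot linearNl raddfN. Qed.

Lemma rdotZl H (a : R) (x z : H) : rdot (a%:C *: x) z = a * rdot x z.
Proof.
by rewrite /rdot linearZl_LR /=; case: '[x, z] => p q /=; rewrite mul0r subr0.
Qed.

Lemma rdotZZi H (x y : H) : rdot ('i *: x) ('i *: y) = rdot x y.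
Proof.
by rewrite /rdot linearZl_LR linearZr_LR /=; case: '[x, y] => p q /=; ring.
Qed.

Lemma sqnD H (x y : H) : sqn (x + y) = sqn x + rdot x y *+ 2 + sqn y.
Proof.
by rewrite /sqn rdotDl rdotC rdotDl (rdotC _ (x + y)) rdotDl (rdotC y x); ring.
Qed.

Lemma sqnN H (x : H) : sqn (- x) = sqn x.
Proof. by rewrite /sqn rdotNl rdotC rdotNl opprK. Qed.

Lemma sqnB H (x y : H) : sqn (x - y) = sqn x - rdot x y *+ 2 + sqn y.
Proof. by rewrite sqnD sqnN rdotC rdotNl rdotC mulNrn. Qed.

Lemma sqnD_le H (x y : H) : sqn (x + y) <= sqn x *+ 2 + sqn y *+ 2.
Proof. by have := sqn_ge0 (x - y); rewrite sqnB sqnD; lra. Qed.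

Lemma sqn_parallelogram H (x y : H) :
  sqn (x - y) = sqn x *+ 2 + sqn y *+ 2 - sqn (x + y).
Proof. by rewrite sqnB sqnD; ring. Qed.

Lemma sqnZr H (a : R) (x : H) : sqn (a%:C *: x) = a ^+ 2 * sqn x.
Proof. by rewrite /sqn rdotZl rdotC rdotZl mulrA. Qed.

Lemma gt0_real (e : R[i]) : 0 < e -> exists2 r : R, 0 < r & e = r%:C.
Proof. by case: e => a b; rewrite ltcE /= => /andP[/eqP -> a0]; exists a. Qed.

Lemma lt_norm_sqn H (x : H) (e : R) :
  0 < e -> (`|x| < e%:C) = (sqn x < e ^+ 2).
Proof.
move=> e0; rewrite norm_sqn ltcR.
rewrite -(ltr_pXn2r (n := 2)) ?nnegrE ?sqrtr_ge0 ?(ltW e0)//.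
by rewrite sqr_sqrtr ?sqn_ge0.
Qed.

Lemma contractive_sqn H K (T : {linear H -> K}) :
  contractive T <-> forall x, sqn (T x) <= sqn x.
Proof. by split=> h x; have := h x; rewrite le_sqn. Qed.

(** The second argument is conjugate-linear, so pairing with ['i *: y] multiplies by -i and turns
    the imaginary part into a real part. *)
Lemma hdot_rdot H (x y : H) :
  '[x, y] = (rdot x y)%:C + 'i * (rdot x ('i *: y))%:C.
Proof.
rewrite /rdot linearZr_LR /=; case: '[x, y] => p q /=.
by apply/eqP; rewrite eq_complex /=; apply/andP; split; apply/eqP; ring.
Qed.
End RealDot.

(** * The Hilbert space of square-summable sequences *)

Section L2.
Variables (R : realType) (H : hilbertType R).

(** The terms are nonnegative, so bounded partial sums amount to summability. *)
Definition sqsum (f : nat -> H) :=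
  exists M : R, forall n, \sum_(0 <= k < n) sqn (f k) <= M.

Definition l2_pred : {pred nat -> H} := fun f => `[< sqsum f >].

Record l2 := L2 { l2_fun :> nat -> H; _ : l2_fun \in l2_pred }.
HB.instance Definition _ := [isSub for l2_fun].
HB.instance Definition _ := [Choice of l2 by <:].

Fact l2_submod_closed : submod_closed l2_pred.
Proof.
split=> [|a f g].
  by apply/asboolP; exists 0 => n; rewrite big1// => k _; rewrite sqn0.
move=> /asboolP[M fM] /asboolP[M' gM']; apply/asboolP.
exists (complex.Re (a * a^*) * M *+ 2 + M' *+ 2) => n.
apply: (@le_trans _ _ (\sum_(0 <= k < n)
   (complex.Re (a * a^*) * sqn (f k) *+ 2 + sqn (g k) *+ 2))).
  by apply: ler_sum => k _; rewrite -sqnZ; exact: sqnD_le.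
rewrite big_split /= !sumrMnl -mulr_sumr lerD// lerMn2r//=.
apply: ler_wpM2l => //.
have : 0 <= a * a^* by rewrite -normCK exprn_ge0.
by case: (_ * _) => p q; rewrite lecE /= => /andP[].
Qed.

HB.instance Definition _ :=
  GRing.isSubmodClosed.Build R[i] (nat -> H) l2_pred l2_submod_closed.
HB.instance Definition _ := [SubChoice_isSubLmodule of l2 by <:].

Implicit Types f g h : l2.

Lemma l2P f g : f =1 g -> f = g.
Proof. by move=> fg; apply/val_inj/funext. Qed.

Lemma l2_sqsum f : sqsum f.
Proof. by case: f => f /= /asboolP. Qed.

(** Polarization writes the sums as differences of sums of squares, which are nondecreasing and
    bounded. *)
Lemma l2_sum_rdot_is_cvg f g :
  cvgn (fun n => \sum_(0 <= k < n) rdot (f k) (g k)).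
Proof.
have sqc (h : l2) : cvgn (fun n => \sum_(0 <= k < n) sqn (h k)).
  apply: nondecreasing_is_cvgn.
    by apply/nondecreasing_seqP => n; rewrite big_nat_recr//= lerDl sqn_ge0.
  by have [M hM] := l2_sqsum h; exists M => _ [n _ <-].
have -> : (fun n => \sum_(0 <= k < n) rdot (f k) (g k)) =
   (fun n => 4^-1 * (\sum_(0 <= k < n) sqn ((f + g) k) -
                     \sum_(0 <= k < n) sqn ((f - g) k))).
  apply/funext => n; rewrite -sumrB mulr_sumr; apply: eq_bigr => k _.
  by rewrite /= sqnD sqnB; field.
by apply: is_cvgMr; exact: is_cvgB.
Qed.

Definition l2_rdot f g : R :=
  limn (fun n => \sum_(0 <= k < n) rdot (f k) (g k)).

(** The imaginary part is defined by the formula of [hdot_rdot], so that only real series occur. *)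
Definition l2_dot f g : R[i] :=
  (l2_rdot f g)%:C + 'i * (l2_rdot f ('i *: g))%:C.

Definition l2_norm f : R[i] := (Num.sqrt (l2_rdot f f))%:C.

Lemma l2_rdotC f g : l2_rdot f g = l2_rdot g f.
Proof.
rewrite /l2_rdot; congr (limn _); apply/funext => n.
by apply: eq_bigr => k _; rewrite rdotC.
Qed.

Lemma l2_rdot_cvg f g :
  (fun n => \sum_(0 <= k < n) rdot (f k) (g k)) @ \oo --> l2_rdot f g.
Proof. exact: l2_sum_rdot_is_cvg. Qed.

Lemma l2_rdotE f g l :
  (fun n => \sum_(0 <= k < n) rdot (f k) (g k)) @ \oo --> l -> l2_rdot f g = l.
Proof. exact: cvg_lim. Qed.

Lemma l2_rdotDl f g h : l2_rdot (f + g) h = l2_rdot f h + l2_rdot g h.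
Proof.
apply: l2_rdotE; under eq_fun do under eq_bigr do rewrite /= rdotDl.
under eq_fun do rewrite big_split /=.
by apply: cvgD; exact: l2_rdot_cvg.
Qed.

Lemma l2_rdotZl (a : R) f g : l2_rdot (a%:C *: f) g = a * l2_rdot f g.
Proof.
apply: l2_rdotE; under eq_fun do under eq_bigr do rewrite /= rdotZl.
under eq_fun do rewrite -mulr_sumr.
by apply: cvgM; [exact: cvg_cst | exact: l2_rdot_cvg].
Qed.

Lemma l2_rdotii f g : l2_rdot ('i *: f) ('i *: g) = l2_rdot f g.
Proof.
rewrite /l2_rdot; congr (limn _); apply/funext => n.
by apply: eq_bigr => k _; rewrite rdotZZi.
Qed.

Lemma l2_rdotNl f g : l2_rdot (- f) g = - l2_rdot f g.
Proof. by have := l2_rdotZl (-1) f g; rewrite rmorphN scaleN1r mulN1r. Qed.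

Lemma l2_rdotil f g : l2_rdot ('i *: f) g = - l2_rdot f ('i *: g).
Proof.
rewrite -[in RHS]l2_rdotii scalerA -expr2 sqr_i scaleN1r.
by rewrite [in RHS]l2_rdotC l2_rdotNl opprK l2_rdotC.
Qed.

Lemma l2_dotC f g : l2_dot f g = (l2_dot g f)^*.
Proof.
rewrite /l2_dot l2_rdotC -(l2_rdotC ('i *: g)) l2_rdotil.
by apply/eqP; rewrite eq_complex /=; apply/andP; split; apply/eqP; ring.
Qed.

Lemma l2_dotDl f g h : l2_dot (f + g) h = l2_dot f h + l2_dot g h.
Proof. by rewrite /l2_dot !l2_rdotDl !rmorphD /=; ring. Qed.

Lemma l2_dotZl a f g : l2_dot (a *: f) g = a * l2_dot f g.
Proof.
have dotZ (b : R) f' : l2_dot (b%:C *: f') g = b%:C * l2_dot f' g.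
  by rewrite /l2_dot !l2_rdotZl !rmorphM /=; ring.
have doti f' : l2_dot ('i *: f') g = 'i * l2_dot f' g.
  rewrite /l2_dot l2_rdotil l2_rdotii.
  by apply/eqP; rewrite eq_complex /=; apply/andP; split; apply/eqP; ring.
by rewrite [a]complexE scalerDl -scalerA l2_dotDl doti !dotZ mulrA mulrDl.
Qed.

Fact l2_dot_bilinear : bilinear_for *%R (@Num.conj R[i] \; *%R) l2_dot.
Proof.
split=> h a f g /=; first by rewrite l2_dotDl l2_dotZl.
by rewrite !(l2_dotC h) l2_dotDl l2_dotZl rmorphD rmorphM.
Qed.
HB.instance Definition _ := bilinear_isBilinear.Build R[i] l2 l2 R[i] *%R
  (@Num.conj R[i] \; *%R) l2_dot l2_dot_bilinear.

Fact l2_dot_hermitian f g : l2_dot f g = (-1) ^+ false * (l2_dot g f)^*.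
Proof. by rewrite expr0 mul1r l2_dotC. Qed.

HB.instance Definition _ := isHermitianSesquilinear.Build R[i] l2 false
  (@Num.conj R[i]) l2_dot l2_dot_hermitian.

Local Notation sq f := (l2_rdot f f).

Lemma le_l2_sum f n : \sum_(0 <= k < n) sqn (f k) <= sq f.
Proof.
apply: nondecreasing_cvgn_le; last exact: l2_sum_rdot_is_cvg.
by apply/nondecreasing_seqP => m; rewrite big_nat_recr//= lerDl sqn_ge0.
Qed.

Lemma l2_sum_le f M :
  (forall n, \sum_(0 <= k < n) sqn (f k) <= M) -> sq f <= M.
Proof.
move=> fM; apply: limr_le; first exact: l2_sum_rdot_is_cvg.
by near=> n; exact: fM.
Unshelve. all: by end_near. Qed.

Lemma l2_sq_ge0 f : 0 <= sq f.
Proof. by have := le_l2_sum f 0; rewrite big_nil. Qed.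

Lemma sqn_le_l2 f k : sqn (f k) <= sq f.
Proof.
apply: le_trans (le_l2_sum f k.+1); rewrite big_nat_recr//= lerDr.
by rewrite sumr_ge0// => i _; exact: sqn_ge0.
Qed.

Lemma l2_sq_eq0 f : sq f = 0 -> f = 0.
Proof.
move=> f0; apply: l2P => k; apply: sqn_eq0; apply/eqP.
by rewrite eq_le sqn_ge0 -f0 sqn_le_l2.
Qed.

Lemma l2_dot_sq f : l2_dot f f = (sq f)%:C.
Proof.
have := l2_rdotil f f; rewrite l2_rdotC => /eqP.
rewrite -addr_eq0 -mulr2n mulrn_eq0/=.
by rewrite /l2_dot => /eqP ->; rewrite mulr0 addr0.
Qed.

Fact l2_dot_gt0 f : f != 0 -> 0 < l2_dot f f.
Proof.
move=> f0; rewrite l2_dot_sq ltcR lt_def l2_sq_ge0 andbT.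
by apply: contraNneq f0 => /l2_sq_eq0 ->.
Qed.

HB.instance Definition _ := isDotProduct.Build R[i] l2 l2_dot l2_dot_gt0.

Lemma l2_CauchySchwarz f g : l2_rdot f g ^+ 2 <= sq f * sq g.
Proof.
have [g0|g0] := eqVneq (sq g) 0.
  have -> : g = 0 by apply: l2_sq_eq0.
  have r0 h : l2_rdot 0 h = 0 by have := l2_rdotZl 0 0 h; rewrite scaler0 mul0r.
  by rewrite l2_rdotC !r0 expr0n mulr0.
(* This is the component of [f] orthogonal to [g], scaled by [sq g] to avoid a division. *)
have := l2_sq_ge0 ((sq g)%:C *: f - (l2_rdot f g)%:C *: g).
rewrite l2_rdotDl l2_rdotNl !l2_rdotZl.
rewrite 2!(l2_rdotC _ (_ - _)) !l2_rdotDl !l2_rdotNl !l2_rdotZl (l2_rdotC g f).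
have : 0 < sq g by rewrite lt_def g0 l2_sq_ge0.
move: (sq f) (sq g) (l2_rdot f g) => a b c b0.
have -> : b * (b * a - c * c) - c * (b * c - c * b) = b * (a * b - c ^+ 2).
  by ring.
by rewrite pmulr_rge0// subr_ge0.
Qed.

Fact l2_norm_triangle f g : l2_norm (f + g) <= l2_norm f + l2_norm g.
Proof.
rewrite /l2_norm -rmorphD lecR.
rewrite -(ler_pXn2r (n := 2)) ?nnegrE ?addr_ge0 ?sqrtr_ge0//.
rewrite sqr_sqrtr ?l2_sq_ge0// sqrrD !sqr_sqrtr ?l2_sq_ge0//.
rewrite l2_rdotDl (l2_rdotC f) (l2_rdotC g) !l2_rdotDl (l2_rdotC g f).
rewrite addrA lerD2r -addrA lerD2l -mulr2n lerMn2r/=.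
rewrite -sqrtrM ?l2_sq_ge0//; apply: le_trans (ler_norm _) _.
by rewrite -sqrtr_sqr ler_sqrt ?l2_CauchySchwarz// mulr_ge0 ?l2_sq_ge0.
Qed.

Fact l2_normZ a f : l2_norm (a *: f) = `|a| * l2_norm f.
Proof.
apply/eqP; rewrite -(eqrXn2 (n := 2))//; first last.
- by rewrite mulr_ge0// lecR sqrtr_ge0.
- by rewrite lecR sqrtr_ge0.
have normE h : l2_norm h ^+ 2 = l2_dot h h.
  by rewrite /l2_norm -rmorphXn /= sqr_sqrtr ?l2_sq_ge0// l2_dot_sq.
by rewrite exprMn !normE linearZl_LR linearZr_LR /= mulrA normCK.
Qed.

Fact l2_norm_eq0 f : l2_norm f = 0 -> f = 0.
Proof.
move=> /complexI/eqP; rewrite sqrtr_eq0 => f0; apply: l2_sq_eq0.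
by apply/eqP; rewrite eq_le f0 l2_sq_ge0.
Qed.

HB.instance Definition _ := Lmodule_isNormed.Build R[i] l2
  l2_norm_triangle l2_normZ l2_norm_eq0.

Lemma l2_sqD_le f g : sq (f + g) <= sq f *+ 2 + sq g *+ 2.
Proof.
have := l2_sq_ge0 (f - g).
rewrite !l2_rdotDl !l2_rdotNl !(l2_rdotC _ (_ + _)).
by rewrite !l2_rdotDl !l2_rdotNl (l2_rdotC g f); lra.
Qed.

Lemma lt_l2_norm (f : l2) (e : R) : 0 < e -> (`|f| < e%:C) = (sq f < e ^+ 2).
Proof.
move=> e0; rewrite -[`|f|]/(l2_norm f) ltcR.
rewrite -(ltr_pXn2r (n := 2)) ?nnegrE ?sqrtr_ge0 ?(ltW e0)//.
by rewrite sqr_sqrtr ?l2_sq_ge0.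
Qed.

(** A Cauchy filter converges in every coordinate. Bounds on finite partial sums, uniform in their
    length, pass to the coordinatewise limit [g]; they show both that [g] is square-summable and
    that the filter converges to it. *)
Lemma l2_complete (F : set_system l2) : ProperFilter F -> cauchy F -> cvg F.
Proof.
move=> FF /cauchyP Fc.
have ball_l2 (f g : l2) (e : R) : 0 < e -> ball f e%:C g -> sq (f - g) < e ^+ 2.
  by move=> e0; rewrite -ball_normE /= -lt_l2_norm.
have cvgk k : cvg ((fun f : l2 => f k) @ F).
  apply: cauchy_cvg; apply/cauchyP => _ /gt0_real[e e0 ->].
  have [|f Ff] := Fc e%:C; first by rewrite ltcR.
  exists (f k); apply: (@filterS _ F _ _ _ _ Ff) => g /(ball_l2 _ _ _ e0) fg.
  have : `|f k - g k| < e%:C.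
    by rewrite lt_norm_sqn//; exact: le_lt_trans (sqn_le_l2 (f - g) k) fg.
  by rewrite -ball_normE.
pose g k := lim ((fun f : l2 => f k) @ F).
have near_g n (e : R) : 0 < e ->
    F [set f : l2 | forall k, (k < n)%N -> sqn (f k - g k) < e ^+ 2].
  move=> e0.
  have : F [set f : l2 | forall k : 'I_n, sqn (f k - g k) < e ^+ 2].
    apply: (@filter_forall _ _ _ F) => k.
    have /cvgrPdist_lt/(_ e%:C) := cvgk k; rewrite ltcR => /(_ e0).
    by apply: (@filterS _ F) => f; rewrite /= distrC lt_norm_sqn.
  by apply: filterS => f fg k kn; exact: (fg (Ordinal kn)).
have close (f0 : l2) (e : R) : 0 < e -> F (ball f0 e%:C) ->
    forall n, \sum_(0 <= k < n) sqn (f0 k - g k) <= e ^+ 2 *+ 3.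
  move=> e0 Ff0 n.
  (* With this coordinatewise precision the [n] errors add up to at most [e ^+ 2 / 2]; together with
     the error [e ^+ 2] of [f0 - f], both doubled by [sqnD_le], this gives the factor 3. *)
  have d0 : 0 < e / (n.+1%:R *+ 2).
    by rewrite divr_gt0// -mulr_natl mulr_gt0 ?ltr0n.
  have [f [ff0 fg]] := filter_ex (filterI Ff0 (near_g n _ d0)).
  have := le_lt_trans (le_l2_sum (f0 - f) n) (ball_l2 _ _ _ e0 ff0).
  have : \sum_(0 <= k < n) sqn (f k - g k) <= e ^+ 2 / 2.
    apply: (@le_trans _ _ (\sum_(0 <= k < n) (e / (n.+1%:R *+ 2)) ^+ 2)).
      by rewrite !big_mkord; apply: ler_sum => k _; apply: ltW; exact: fg.
    rewrite sumr_const_nat subn0 -[_ *+ n]mulr_natl -[n.+1%:R]natr1.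
    have q0 : 0 <= n%:R :> R by [].
    set q := n%:R in q0 *; set d := e / _.
    have -> : e = d * (q + 1) * 2 by rewrite /d; field; rewrite gt_eqF//; lra.
    rewrite -subr_ge0.
    have -> : (d * (q + 1) * 2) ^+ 2 / 2 - q * d ^+ 2 =
        d ^+ 2 * (2 * q ^+ 2 + 3 * q + 2).
      by field.
    by rewrite mulr_ge0 ?sqr_ge0//; nra.
  have : \sum_(0 <= k < n) sqn (f0 k - g k) <=
      (\sum_(0 <= k < n) sqn ((f0 - f) k)) *+ 2 +
      (\sum_(0 <= k < n) sqn (f k - g k)) *+ 2.
    rewrite -!sumrMnl -big_split; apply: ler_sum => k _ /=.
    by rewrite -[f0 k](subrK (f k)) -addrA; exact: sqnD_le.
  by lra.
have gl2 : g \in l2_pred.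
  have [|f0 Ff0] := Fc 1%:C; first by rewrite ltcR.
  apply/asboolP; exists (sq f0 *+ 2 + (1 ^+ 2 *+ 3) *+ 2) => n.
  apply: (@le_trans _ _ ((\sum_(0 <= k < n) sqn (f0 k)) *+ 2 +
                         (\sum_(0 <= k < n) sqn (f0 k - g k)) *+ 2)).
    rewrite -!sumrMnl -big_split; apply: ler_sum => k _ /=.
    by rewrite -{1}[g k](subKr (f0 k)) -(sqnN (f0 k - g k)); exact: sqnD_le.
  by rewrite lerD// lerMn2r/= ?le_l2_sum//; exact: close.
apply/cvg_ex; exists (L2 gl2); apply/cvgrPdist_lt => _ /gt0_real[e e0 ->].
have [|f0 Ff0] := Fc (e / 4)%:C; first by rewrite ltcR divr_gt0.
apply: filterS (Ff0) => f /ball_l2; rewrite divr_gt0// => /(_ isT) f0f.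
rewrite lt_l2_norm// -(subrKA f0); apply: le_lt_trans (l2_sqD_le _ _) _.
rewrite -[_ - _ in X in X *+ 2 + _]opprB l2_rdotNl l2_rdotC l2_rdotNl opprK.
have : sq (f0 - L2 gl2) <= (e / 4) ^+ 2 *+ 3.
  by apply: l2_sum_le; apply: (close f0 _ _ Ff0); rewrite divr_gt0.
by move: f0f; rewrite expr_div_n; have := exprn_gt0 2 e0; lra.
Qed.

HB.instance Definition _ := Uniform_isComplete.Build l2 l2_complete.

Fact l2_dot_norm f : l2_dot f f = `|f| ^+ 2.
Proof.
rewrite -[`|f|]/(l2_norm f) /l2_norm -rmorphXn /= sqr_sqrtr ?l2_sq_ge0//.
exact: l2_dot_sq.
Qed.

HB.instance Definition _ :=
  CompleteNormedModule_isHilbert.Build R l2 l2_dot_norm.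
End L2.

(** * Orthogonal complements and reflections *)

Section Projection.
Variables (R : realType) (H : hilbertType R).
Implicit Types (S : set H) (x y : H).

Definition orthc S : set H := [set y | forall s, S s -> '[s, y] = 0].

Lemma orthcP S a x y : orthc S x -> orthc S y -> orthc S (a *: x + y).
Proof.
by move=> Sx Sy s Ss; rewrite linearPr /= Sx// Sy// mulr0 addr0.
Qed.

Lemma orthc0 S : orthc S 0.
Proof. by move=> s _; rewrite linear0r. Qed.

(** Orthogonality passes to norm limits by Cauchy-Schwarz. *)
Lemma orthc_closed S p :
  (forall e : R, 0 < e -> exists2 y, orthc S y & `|p - y| < e%:C) -> orthc S p.
Proof.
move=> py s Ss; apply/eqP/negPn/negP; rewrite -normr_gt0 => /gt0_real[r r0 rE].
have s0 : 0 <= Num.sqrt (sqn s) := sqrtr_ge0 _.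
have [|y Sy yp] := py (r / (Num.sqrt (sqn s) + 1)).
  by rewrite divr_gt0//; lra.
have := hdot_CauchySchwarz s (p - y).
rewrite linearBr /= (Sy _ Ss) subr0 rE (norm_sqn s) => h.
have := le_trans h (ler_wpM2l _ (ltW yp)); rewrite lecR => /(_ s0).
rewrite -rmorphM /= lecR mulrA ler_pdivlMr; last lra.
by nra.
Qed.

(** The point [p] is the one of the complement nearest to [x]: the parallelogram law makes
    near-minimizers a Cauchy filter, and minimality of its limit forces orthogonality. *)
Lemma orthc_proj S x : exists2 p, orthc S p &
  forall y, orthc S y -> '[x - p, y] = 0.
Proof.
pose D := [set sqn (x - y) | y in orthc S].
have Dinf : has_inf D.
  split; first by exists (sqn (x - 0)), 0 => //; exact: orthc0.
  by exists 0 => _ [y _ <-]; exact: sqn_ge0.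
pose d := inf D.
have dle y : orthc S y -> d <= sqn (x - y).
  by move=> Sy; apply: ge_inf; [exact: Dinf.2 | exists y].
pose B e := [set y | orthc S y /\ sqn (x - y) < d + e].
pose F := filter_from [set e : R | 0 < e] B.
have FF : ProperFilter F.
  apply: filter_from_proper; last first.
    move=> e /= e0; have [_ [y Sy <-] ye] := inf_adherent e0 Dinf.
    by exists y.
  apply: filter_from_filter; first by exists 1 => /=.
  move=> e e' /= e0 e'0; exists (Num.min e e'); first by rewrite /= lt_min e0.
  by move=> y [Sy]; rewrite -ltrBlDl lt_min => /andP[? ?]; split; split=> //;
    rewrite -ltrBlDl.
have Bclose e y z : B e y -> B e z -> sqn (y - z) < 4 * e.
  move=> [Sy ye] [Sz ze].
  have := sqn_parallelogram (x - z) (x - y).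
  rewrite opprB addrC subrKA => ->.
  have := dle _ (orthcP 2^-1 (orthcP 1 Sy Sz) (@orthc0 S)).
  rewrite addr0 scale1r => dyz.
  have -> : x - z + (x - y) = 2%:C *: (x - 2^-1 *: (y + z)).
    rewrite scalerBr scalerA rmorphMn /= divff ?pnatr_eq0// scale1r.
    by rewrite scaler_nat mulr2n opprD addrACA (addrC (- z)).
  by rewrite sqnZr; lra.
have : cvg F.
  apply: cauchy_cvg; apply/cauchyP => _ /gt0_real[e e0 ->].
  have e40 : 0 < e ^+ 2 / 4 by rewrite divr_gt0// exprn_gt0.
  have [_ [y Sy <-] ye] := inf_adherent e40 Dinf.
  exists y, (e ^+ 2 / 4) => // z Bz.
  have : `|y - z| < e%:C.
    by rewrite lt_norm_sqn//; have := Bclose _ y z (conj Sy ye) Bz; lra.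
  by rewrite -ball_normE.
move=> /cvg_ex[/= p Fp].
have app e : 0 < e ->
    exists y, [/\ orthc S y, sqn (x - y) < d + e & `|p - y| < e%:C].
  move=> e0.
  have h1 : F (B e) by exists e.
  have h2 : F (ball p e%:C) by apply: Fp; apply: nbhsx_ballx; rewrite ltcR.
  have [y [[Sy ye] yb]] := filter_ex (filterI h1 h2).
  by exists y; split=> //; move: yb; rewrite -ball_normE.
have Sp : orthc S p by apply: orthc_closed => e /app[y [Sy _ yp]]; exists y.
exists p => // y Sy.
have xpd : sqn (x - p) <= d.
  pose a := Num.sqrt (sqn (x - p)); have a0 : 0 <= a by exact: sqrtr_ge0.
  have d0 : 0 <= d.
    by apply: lb_le_inf; [exact: Dinf.1 | move=> _ [z _ <-]; exact: sqn_ge0].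
  have -> : sqn (x - p) = a ^+ 2 by rewrite sqr_sqrtr// sqn_ge0.
  apply/ler_addgt0Pl => eps eps0.
  (* Chosen so that a <= b + e and b^2 < d + e yield a^2 <= d + e (1 + 2 a) = d + eps. *)
  have e0 : 0 < eps / (1 + 2 * a) by rewrite divr_gt0//; lra.
  have [z [Sz ye yp]] := app _ e0.
  have epsE : eps = eps / (1 + 2 * a) * (1 + 2 * a).
    by rewrite divfK// gt_eqF//; lra.
  move: ye yp epsE e0; set e := eps / _ => ye yp -> e0.
  set b := Num.sqrt (sqn (x - z)); have b0 : 0 <= b by exact: sqrtr_ge0.
  have bE : sqn (x - z) = b ^+ 2 by rewrite sqr_sqrtr// sqn_ge0.
  have ab : a <= b + e.
    rewrite -lecR rmorphD /= -!norm_sqn -[x - p](subrKA z).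
    by apply: le_trans (ler_normD _ _) _; rewrite lerD2l distrC ltW.
  rewrite bE in ye; have [ae|ea] := lerP a e; first nra.
  have : (a - e) ^+ 2 <= b ^+ 2 by rewrite ler_sqr ?nnegrE; lra.
  by nra.
have [->|y0] := eqVneq y 0; first by rewrite linear0r.
(* Moving [p] by the projection of [x - p] on [y] would lower the squared distance by |<x - p, y>|^2
   / |y|^2. *)
have := dle _ (orthcP ('[x - p, y] / '[y, y]) Sy Sp).
rewrite opprD addrA addrAC => /(le_trans xpd).
rewrite -lecR -!hdot_sqn (hdot_norm (x - p)) (hdot_norm (_ - _ *: _)).
rewrite normB_proj//.
rewrite lerBrDl gerDr pmulr_lle0 ?invr_gt0 ?exprn_gt0 ?normr_gt0//.
by move=> h; apply/eqP; rewrite -normr_eq0 -sqrf_eq0 eq_le h exprn_ge0.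
Qed.

(** [V] is 1 - 2 p with p the orthogonal projection onto [orthc S]. Uniqueness of the projection
    ([pE]) gives linearity and all the listed properties. *)
Lemma orthc_reflection S : exists V : {linear H -> H},
  [/\ forall x, V (V x) = x, forall x y, '[V x, y] = '[x, V y],
      forall s, S s -> V s = s & forall x, orthc S x -> V x = - x].
Proof.
have [p Sp px] : exists2 p : H -> H, forall x, orthc S (p x) &
    forall x y, orthc S y -> '[x - p x, y] = 0.
  have /choice[p hp] : forall x, exists p,
      orthc S p /\ forall y, orthc S y -> '[x - p, y] = 0.
    by move=> x; have [p ? ?] := orthc_proj S x; exists p.
  by exists p => x; have [] := hp x.
have pE x q : orthc S q -> (forall y, orthc S y -> '[x - q, y] = 0) -> p x = q.
  move=> Sq qx; apply/eqP; rewrite -subr_eq0 -normr_eq0 -sqrf_eq0 -hdot_norm.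
  have Spq : orthc S (p x - q) by rewrite addrC -scaleN1r; exact: orthcP.
  rewrite -{1}(subrKA x) -opprB linearDl linearNl /= px// qx//.
  by rewrite oppr0 addr0.
have plin : linear (fun x => x - p x *+ 2).
  move=> a x y; rewrite (pE _ (a *: p x + p y)); last 2 first.
  - exact: orthcP.
  - move=> z Sz; rewrite opprD addrACA -scalerBr linearPl /= !px//.
    by rewrite mulr0 addr0.
  by rewrite mulrnDl scalerMnr scalerBr opprD addrACA.
pose V0 : H -> H := fun x => x - p x *+ 2.
pose VL := GRing.isLinear.Build R[i] H H *:%R V0 plin.
pose V : {linear H -> H} := HB.pack V0 VL.
have VE x : V x = x - p x *+ 2 by [].
exists V; split.
- have linp x : p (V x) = - p x.
    apply: pE.
      by rewrite -scaleN1r -[_ *: _]addr0; apply: orthcP => //; exact: orthc0.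
    by move=> y Sy; rewrite VE opprK mulr2n opprD addrA subrK px.
  by move=> x; rewrite VE linp VE mulNrn opprK subrK.
- have sa x y : '[p x, y] = '[x, p y].
    rewrite -[in LHS](subrK (p y) y) -[in RHS](subrK (p x) x).
    by rewrite linearDr linearDl /= px// add0r hdotC px// rmorph0 add0r.
  by move=> x y; rewrite !VE linearBl linearBr /= linearMnl linearMnr /= sa.
- move=> s Ss; have ps : p s = 0.
    by apply: pE => [|y Sy]; [exact: orthc0 | rewrite subr0 Sy].
  by rewrite VE ps mul0rn subr0.
- move=> x Sx; have px1 : p x = x.
    by apply: pE => // y _; rewrite subrr linear0l.
  by rewrite VE px1 mulr2n opprD addrA subrr sub0r.
Qed.
End Projection.

(** * Strong stability *)

Section Stability.
Variables (R : realType) (H : hilbertType R).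
Implicit Types (x y : H).

(** For a contraction the norms of the iterates decrease, so one small iterate for each [e] means
    convergence to 0. *)
Definition stable (C : H -> H) x :=
  forall e : R, 0 < e -> exists m, sqn (iter m C x) < e.

Section Contraction.
Variable C : {linear H -> H}.
Hypothesis Cc : contractive C.

Lemma sqn_iter_le m x : sqn (iter m C x) <= sqn x.
Proof.
by elim: m => //= m; apply: le_trans; exact: (contractive_sqn C).1.
Qed.

Lemma iter_linearD m x y : iter m C (x + y) = iter m C x + iter m C y.
Proof. by elim: m => //= m ->; rewrite linearD. Qed.

(** Later iterates of the error stay small by contractivity. The case m = 0 says that the stable
    vectors are closed; general [m] serves block triangular operators. *)
Lemma stable_approx x : (forall e : R, 0 < e -> exists m y,
  stable C y /\ sqn (iter m C x - y) < e) -> stable C x.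
Proof.
move=> h e e0; have [|m [y [Cy my]]] := h (e / 4); first by rewrite divr_gt0.
have [|k ky] := Cy (e / 4); first by rewrite divr_gt0.
exists (k + m)%N; rewrite iterD -[iter m C x](subrK y) iter_linearD.
apply: le_lt_trans (sqnD_le _ _) _.
by have := sqn_iter_le k (iter m C x - y); lra.
Qed.

Lemma stableD x y : stable C x -> stable C y -> stable C (x + y).
Proof.
move=> Cx Cy e e0.
have [|k kx] := Cx (e / 4); first by rewrite divr_gt0.
have [|m my] := Cy (e / 4); first by rewrite divr_gt0.
exists (k + m)%N; rewrite iter_linearD {1}addnC !iterD.
apply: le_lt_trans (sqnD_le _ _) _.
have := sqn_iter_le m (iter k C x); have := sqn_iter_le k (iter m C y).
by lra.
Qed.

Lemma stable_image x : stable C x -> stable C (C x).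
Proof.
move=> Cx e /Cx[m hm]; exists m; rewrite -iterSr iterS.
exact: le_lt_trans ((contractive_sqn C).1 Cc _) hm.
Qed.

Lemma stable0 : stable C 0.
Proof. by move=> e e0; exists 0%N; rewrite /= sqn0. Qed.

End Contraction.

Lemma pure_contractionP (C D : {linear H -> H}) :
  contractive C -> contractive D -> adjoint C =1 D ->
  (pure_contraction C <-> forall x, stable D x).
Proof.
move=> Cc Dc /funext E; rewrite /pure_contraction E; split.
  move=> [_ h] x e e0; have s0 : 0 < Num.sqrt e by rewrite sqrtr_gt0.
  have /cvgrPdist_lt/(_ (Num.sqrt e)%:C) := h x.
  rewrite ltcR => /(_ s0)[m _ /(_ m (leqnn _))].
  rewrite /= sub0r normrN normr_id lt_norm_sqn// sqr_sqrtr ?(ltW e0)// => hm.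
  by exists m.
move=> h; split=> // x; apply/cvgrPdist_lt => _ /gt0_real[e e0 ->].
have [|m hm] := h x (e ^+ 2); first exact: exprn_gt0.
exists m => // k /= mk; rewrite sub0r normrN normr_id lt_norm_sqn//.
by apply: le_lt_trans hm; rewrite -(subnK mk) iterD; exact: sqn_iter_le.
Qed.

End Stability.

(** * Operators on sequences *)

Section L2Operators.
Variable R : realType.
Implicit Types H K : hilbertType R.

Lemma l2_linear (V : lmodType R[i]) K (F : V -> nat -> K) :
  (forall a u v k, F (a *: u + v) k = a *: F u k + F v k) ->
  (forall v, sqsum (F v)) ->
  exists Phi : {linear V -> l2 K}, forall v k, Phi v k = F v k.
Proof.
move=> Flin Fsq; have memF v : F v \in @l2_pred R K by exact/asboolP.
pose Phi0 v : l2 K := L2 (memF v).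
have lin : linear Phi0 by move=> a u v; apply: l2P => k; exact: Flin.
pose PhiL := GRing.isLinear.Build R[i] V (l2 K) *:%R Phi0 lin.
pose Phi : {linear V -> l2 K} := HB.pack Phi0 PhiL.
by exists Phi.
Qed.

Lemma l2_hdot_eq H K (f g : l2 H) (f' g' : l2 K) :
  (forall k, '[f k, g k] = '[f' k, g' k]) -> '[f, g] = '[f', g'].
Proof.
move=> fg; rewrite -[LHS]/(l2_dot f g) -[RHS]/(l2_dot f' g') /l2_dot /l2_rdot.
congr (_%:C + 'i * _%:C); congr (limn _); apply/funext => n;
  apply: eq_bigr => k _; rewrite /rdot; first by rewrite fg.
rewrite [_ ('i *: g) k]/(_ *: _) [_ ('i *: g') k]/(_ *: _).
by rewrite !linearZr_LR /= fg.
Qed.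

(** The imaginary part is a real part against ['i *: y], and [B] commutes with multiplication by
    ['i]. *)
Lemma hdot_adjoint H K (A : {linear H -> K}) (B : {linear K -> H}) :
  (forall x y, rdot (A x) y = rdot x (B y)) ->
  forall x y, '[A x, y] = '[x, B y].
Proof. by move=> AB x y; rewrite !hdot_rdot !AB linearZ. Qed.

Lemma rdot_l2 H (f g : l2 H) : rdot f g = l2_rdot f g.
Proof.
by rewrite /rdot -[hdot _ _]/(l2_dot f g) /= mul0r mul1r oppr0 !addr0.
Qed.

Lemma l2_map H (phi : {linear H -> H}) : contractive phi ->
  exists Phi : {linear l2 H -> l2 H}, forall f k, Phi f k = phi (f k).
Proof.
move=> /contractive_sqn phic; apply: l2_linear => [a f g k|f].
  by rewrite [_ k]/(_ *: _ + _) linearP.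
have [M fM] := l2_sqsum f; exists M => n; apply: le_trans (fM n).
by apply: ler_sum => k _.
Qed.

Lemma l2_shift H : exists Sf Sb : {linear l2 H -> l2 H},
  [/\ forall f k, Sf f k = if k is n.+1 then f n else 0,
      forall f k, Sb f k = f k.+1 & forall f g, '[Sf f, g] = '[f, Sb g]].
Proof.
have [Sf SfE] : exists Sf : {linear l2 H -> l2 H},
    forall f k, Sf f k = if k is n.+1 then f n else 0.
  apply: (@l2_linear _ _ (fun (f : l2 H) k => if k is n.+1 then f n else 0)).
    by move=> a f g [|k] //; rewrite scaler0 addr0.
  move=> f; have [M fM] := l2_sqsum f; exists M => -[|n].
    by have := fM 0; rewrite !big_nil.
  by rewrite big_nat_recl//= sqn0 add0r.
have [Sb SbE] : exists Sb : {linear l2 H -> l2 H}, forall f k, Sb f k = f k.+1.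
  apply: (@l2_linear _ _ (fun (f : l2 H) k => f k.+1)) => // f.
  have [M fM] := l2_sqsum f; exists M => n; apply: le_trans (fM n.+1).
  by rewrite big_nat_recl//= lerDr sqn_ge0.
exists Sf, Sb; split=> //; apply: hdot_adjoint => f g; rewrite !rdot_l2.
apply: l2_rdotE; rewrite -cvg_shiftS.
under eq_fun do rewrite big_nat_recl//= SfE /rdot linear0l add0r.
rewrite (_ : (fun _ => _) = fun n => \sum_(0 <= k < n) rdot (f k) (Sb g k)).
  exact: l2_rdot_cvg.
by apply/funext => n; apply: eq_bigr => k _; rewrite SfE SbE.
Qed.

(** Exchanges 2j and 2j+1, hence the even slots kept by the projection of [l2_even] and the odd
    slots. *)
Definition pair_swap k := if odd k then k.-1 else k.+1.

Lemma pair_swapK : involutive pair_swap.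
Proof.
move=> k; rewrite /pair_swap.
case: (boolP (odd k)) => ko /=; last by rewrite ko.
by case: k ko => //= k /negbTE ->.
Qed.

Lemma big_swap (V : nmodType) (F : nat -> V) n :
  \sum_(0 <= k < n.*2) F (pair_swap k) = \sum_(0 <= k < n.*2) F k.
Proof.
elim: n => [|n IH]; first by rewrite !big_nil.
rewrite doubleS !big_nat_recr//= IH /pair_swap /= odd_double /=.
by rewrite -!addrA (addrC (F _.+1)).
Qed.

Lemma l2_swap H : exists sg : {linear l2 H -> l2 H},
  [/\ forall f k, sg f k = f (pair_swap k), forall f, sg (sg f) = f &
      forall f g, '[sg f, g] = '[f, sg g]].
Proof.
have [sg sgE] : exists sg : {linear l2 H -> l2 H},
    forall f k, sg f k = f (pair_swap k).
  apply: (@l2_linear _ _ (fun (f : l2 H) k => f (pair_swap k))) => // f.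
  have [M fM] := l2_sqsum f; exists M => n; apply: le_trans (fM n.*2).
  rewrite -(big_swap (fun k => sqn (f k))) -addnn.
  rewrite (@big_cat_nat _ _ _ n 0 (n + n))//= ?leq_addr// lerDl.
  by rewrite sumr_ge0// => k _; exact: sqn_ge0.
exists sg; split=> [//|f|]; first by apply: l2P => k; rewrite !sgE pair_swapK.
apply: hdot_adjoint => f g; rewrite !rdot_l2.
(* The swap preserves sums of even length, so the two limits are compared along even indices. *)
have dbl : (fun n => n.*2) @ \oo --> \oo.
  apply/cvgnyPge => N; exists N => // n /=; rewrite -addnn => /leq_trans; apply.
  exact: leq_addr.
have := cvg_comp _ _ dbl (@l2_rdot_cvg _ _ (sg f) g).
have := cvg_comp _ _ dbl (@l2_rdot_cvg _ _ f (sg g)).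
rewrite (_ : _ \o _ =
    (fun n => \sum_(0 <= k < n) rdot (sg f k) (g k)) \o (fun n => n.*2)).
  by move=> h1 h2; exact: cvg_unique h2 h1.
apply/funext => n /=; rewrite -[LHS]big_swap.
by apply: eq_bigr => k _; rewrite !sgE pair_swapK.
Qed.

Lemma l2_even H : exists P : {linear l2 H -> l2 H},
  [/\ forall f k, P f k = if odd k then 0 else f k, forall f, P (P f) = P f &
      forall f g, '[P f, g] = '[f, P g]].
Proof.
have [P PE] : exists P : {linear l2 H -> l2 H},
    forall f k, P f k = if odd k then 0 else f k.
  apply: (@l2_linear _ _ (fun (f : l2 H) k => if odd k then 0 else f k)).
    by move=> a f g k; case: ifP => //; rewrite scaler0 addr0.
  move=> f; have [M fM] := l2_sqsum f; exists M => n; apply: le_trans (fM n).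
  by apply: ler_sum => k _; case: ifP => // _; rewrite sqn0 sqn_ge0.
exists P; split=> // [f|f g].
  by apply: l2P => k; rewrite !PE; case: odd.
apply: l2_hdot_eq => k.
by rewrite !PE; case: ifP => // _; rewrite linear0l linear0r.
Qed.

End L2Operators.

(** * Finitely supported sequences and their density *)

Section Density.
Variables (R : realType) (H : hilbertType R).

Lemma l2_single : exists d : nat -> {linear H -> l2 H},
  (forall n x k, d n x k = if k == n then x else 0) /\
  (forall n x f, '[d n x, f] = '[x, f n]).
Proof.
have sumE (u : nat -> R) n m :
    \sum_(0 <= k < m) (if k == n then u k else 0) =
    if (n < m)%N then u n else 0.
  elim: m => [|m IH]; first by rewrite big_nil.
  rewrite big_nat_recr//= IH ltnS.
  by case: ltngtP => // [_|_|->]; rewrite ?addr0 ?add0r.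
suff /choice[d dE] : forall n, exists d : {linear H -> l2 H},
    forall x k, d x k = if k == n then x else 0.
  have rd n x (f : l2 H) : rdot (d n x) f = rdot x (f n).
    rewrite rdot_l2; apply: l2_rdotE; apply: cvg_near_cst.
    exists n.+1 => // m /= nm.
    under eq_bigr do rewrite dE (fun_if (fun z => rdot z _)) {2}/rdot linear0l.
    by rewrite sumE nm.
  by exists d; split=> // n x f; rewrite !hdot_rdot !rd.
move=> n.
apply: (@l2_linear _ _ _ (fun (x : H) k => if k == n then x else 0)).
  by move=> a x y k; case: ifP => //; rewrite scaler0 addr0.
move=> x; exists (sqn x) => m.
under eq_bigr do rewrite (fun_if (@sqn R H)) sqn0.
by rewrite (sumE (fun=> sqn x)); case: ifP => // _; exact: sqn_ge0.
Qed.

(** Sums of stable vectors are stable, truncations of [f] are finite sums of one-slot vectors, and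
    they approximate [f] in norm. *)
Lemma stable_l2 (C : {linear l2 H -> l2 H}) (d : nat -> {linear H -> l2 H}) :
  (forall n x k, d n x k = if k == n then x else 0) ->
  contractive C -> (forall n x, stable C (d n x)) -> forall f, stable C f.
Proof.
move=> dE Cc Cd f; apply: (stable_approx Cc) => e e0.
have /cvgrPdist_lt/(_ e e0)[N _ /(_ N (leqnn _)) /= hN] := @l2_rdot_cvg _ _ f f.
exists 0%N, (\sum_(n < N) d n (f n)); split.
  elim/big_rec: _ => [|n x _ Cx]; [exact: stable0 | exact: stableD].
have vE k : (\sum_(n < N) d n (f n)) k = if (k < N)%N then f k else 0.
  have -> : (\sum_(n < N) d n (f n)) k = \sum_(n < N) (d n (f n) k).
    by elim/big_rec2: _ => // n x y _ <-.
  under eq_bigr do rewrite dE.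
  case: ifPn => kN; last first.
    rewrite big1// => n _; case: eqP => // kn.
    by rewrite kn ltn_ord in kN.
  rewrite (bigD1 (Ordinal kN))//= eqxx big1 ?addr0// => n nk.
  by case: eqP => // kn; case/eqP: nk; exact/val_inj.
apply: le_lt_trans (le_lt_trans (ler_norm _) hN).
rewrite [iter _ _ _]/= /sqn rdot_l2; apply: l2_sum_le => n.
rewrite lerBrDr; apply: le_trans (le_l2_sum f (N + n)).
pose r k := sqn ((f - \sum_(n < N) d n (f n)) k).
have rE k : r k = if (k < N)%N then 0 else sqn (f k).
  transitivity (sqn (f k - (\sum_(n < N) d n (f n)) k)) => //; rewrite vE.
  by case: ifP; rewrite ?subrr ?sqn0// subr0.
have sumN (F : nat -> R) : \sum_(0 <= k < N + n) F k =
    \sum_(0 <= k < N) F k + \sum_(N <= k < N + n) F k.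
  by rewrite (@big_cat_nat _ _ _ N 0 (N + n))//= leq_addr.
rewrite (sumN (fun k => sqn (f k))) [leRHS]addrC lerD2r.
apply: (@le_trans _ _ (\sum_(0 <= k < N + n) r k)).
  rewrite (@big_cat_nat _ _ _ n 0 (N + n))//= ?leq_addl// lerDl.
  by rewrite sumr_ge0// => k _; exact: sqn_ge0.
rewrite sumN big_nat big1 ?add0r => [|k /= kN]; last by rewrite rE kN.
rewrite !big_nat; apply: ler_sum => k /andP[Nk _].
by rewrite rE ltnNge Nk.
Qed.
End Density.

(** * Berger-Coburn-Lebow pairs *)

Section ShiftModel.
Variables (R : realType) (E : hilbertType R).

Lemma selfadjoint_involution_sqn (H : hilbertType R) (T : {linear H -> H}) :
  (forall x, T (T x) = x) -> (forall x y, '[T x, y] = '[x, T y]) ->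
  forall x, sqn (T x) = sqn x.
Proof. by move=> TT Ts x; rewrite /sqn /rdot Ts TT. Qed.

Lemma selfadjoint_projection_sqn (H : hilbertType R) (P : {linear H -> H}) :
  (forall x, P (P x) = P x) -> (forall x y, '[P x, y] = '[x, P y]) ->
  forall x, sqn (P x) <= sqn x.
Proof.
move=> PP Ps x; have := sqn_ge0 (x - P x).
by rewrite sqnB /sqn /rdot Ps PP -[in '[x, P x]]PP -Ps; lra.
Qed.

Variables P sg rf : {linear E -> E}.
Hypothesis PP : forall x, P (P x) = P x.
Hypothesis Ps : forall x y, '[P x, y] = '[x, P y].
Hypothesis sgsg : forall x, sg (sg x) = x.
Hypothesis sgs : forall x y, '[sg x, y] = '[x, sg y].
Hypothesis rfrf : forall x, rf (rf x) = x.
Hypothesis rfs : forall x y, '[rf x, y] = '[x, rf y].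
(** The symmetry [sg] exchanges the ranges of [P] and 1 - P. *)
Hypothesis sgP : forall x, sg (P x) = sg x - P (sg x).
Hypothesis stab : forall x, stable (sg \o rf \o P) x.

(* On l2 E = H^2(E), let A = P + (1 - P) S with S the backward shift.  The
   adjoints V1^* = sg A sg rf sg and V2^* = sg rf A have product S: this is the
   Berger-Coburn-Lebow pair of the unitary sg rf and the projection P. *)
Lemma shift_model : exists V1 V2 : {linear l2 E -> l2 E},
  [/\ commuting_pure_isometries V1 V2,
      forall f n, adjoint V1 f n =
        let g k := rf (sg (f k)) in g n - P (g n) + P (g n.+1) &
      forall f n, adjoint V2 f n = sg (rf (P (f n) + (f n.+1 - P (f n.+1))))].
Proof.
have Pc : contractive P.
  by apply/contractive_sqn; exact: selfadjoint_projection_sqn.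
have sgc : contractive sg.
  by apply/contractive_sqn => x; rewrite selfadjoint_involution_sqn.
have rfc : contractive rf.
  by apply/contractive_sqn => x; rewrite selfadjoint_involution_sqn.
have [Pm PmE] := l2_map Pc.
have [sm smE] := l2_map sgc.
have [rm rmE] := l2_map rfc.
have [Sf [Sb [SfE SbE SfSb]]] := l2_shift E.
have Pms f g : '[Pm f, g] = '[f, Pm g].
  by apply: l2_hdot_eq => k; rewrite !PmE.
have sms f g : '[sm f, g] = '[f, sm g].
  by apply: l2_hdot_eq => k; rewrite !smE.
have rms f g : '[rm f, g] = '[f, rm g].
  by apply: l2_hdot_eq => k; rewrite !rmE.
have smK f : sm (sm f) = f by apply: l2P => k; rewrite !smE.
have rmK f : rm (rm f) = f by apply: l2P => k; rewrite !rmE.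
pose A : {linear l2 E -> l2 E} := Pm \+ (Sb \- (Pm \o Sb)).
pose As : {linear l2 E -> l2 E} := Pm \+ (Sf \- (Pm \o Sf)).
have AE f n : A f n = P (f n) + (f n.+1 - P (f n.+1)).
  by transitivity (Pm f n + (Sb f n - Pm (Sb f) n)) => //; rewrite !PmE SbE.
have AsE f n : As f n = P (f n) + (if n is k.+1 then f k - P (f k) else 0).
  transitivity (Pm f n + (Sf f n - Pm (Sf f) n)) => //; rewrite !PmE SfE.
  by case: n => //; rewrite linear0 subr0.
have AsA f g : '[As f, g] = '[f, A g].
  rewrite -[As f]/(Pm f + (Sf f - Pm (Sf f))).
  rewrite -[A g]/(Pm g + (Sb g - Pm (Sb g))).
  rewrite linearDl linearDr /= Pms linearBl linearBr /= Pms !SfSb.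
  congr (_ + (_ - '[_, _])).
  by apply: l2P => k; rewrite SbE !PmE SbE.
have AAs f : A (As f) = f.
  apply: l2P => n; rewrite AE !AsE; case: n => [|n].
    rewrite addr0 PP linearD linearB /= !PP subrr addr0.
    by rewrite (addrC (P (f 1%N))) addrK addrC subrK.
  rewrite !linearD !linearN /= !PP !subrr !addr0.
  by rewrite (addrC (P (f n.+2))) addrK addrC subrK.
(* Conjugation by [sm] turns [As] = P + z (1 - P) into (1 - P) + z P, and the product of these two
   is the shift z. Hence [V1] and [V2], composed in either order, give [Sf]. *)
have AsmAs f : As (sm (As f)) = sm (Sf f).
  have sgAs n : sg (As f n) = sg (f n) - P (sg (f n)) +
      (if n is k.+1 then P (sg (f k)) else 0).
    rewrite AsE linearD /= sgP; congr (_ + _).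
    by case: n => [|k]; rewrite ?linear0// linearB /= sgP opprB addrC subrK.
  apply: l2P => n; rewrite [RHS]smE SfE AsE smE sgAs.
  case: n => [|n]; first by rewrite !addr0 linearB /= PP subrr linear0.
  rewrite smE sgAs !linearD !linearN /= !PP subrr add0r subrr add0r.
  case: n => [|n] /=; first by rewrite linear0 subr0 addr0 addrC subrK.
  by rewrite PP addrK addrC subrK.
pose V1 : {linear l2 E -> l2 E} := sm \o rm \o sm \o As \o sm.
pose V2 : {linear l2 E -> l2 E} := As \o rm \o sm.
pose W1 : {linear l2 E -> l2 E} := sm \o A \o sm \o rm \o sm.
pose W2 : {linear l2 E -> l2 E} := sm \o rm \o A.
have V1W1 f : adjoint V1 f = W1 f.
  by apply: adjoint_uniq => g; rewrite /V1 /W1 /= sms rms sms AsA sms.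
have V2W2 f : adjoint V2 f = W2 f.
  by apply: adjoint_uniq => g; rewrite /V2 /W2 /= AsA rms sms.
have sqnAs f : sqn (As f) = sqn f by rewrite /sqn /rdot AsA AAs.
have sqns f : sqn (sm f) = sqn f by exact: selfadjoint_involution_sqn.
have sqnr f : sqn (rm f) = sqn f by exact: selfadjoint_involution_sqn.
have iso (T : {linear l2 E -> l2 E}) :
    (forall f, sqn (T f) = sqn f) -> isometric T.
  by move=> Ti f; rewrite !norm_sqn Ti.
have isoc (T : {linear l2 E -> l2 E}) :
    (forall f, sqn (T f) = sqn f) -> contractive T.
  by move=> Ti; apply/contractive_sqn => f; rewrite Ti.
have sV1 f : sqn (V1 f) = sqn f by rewrite /V1 /= sqns sqnr sqns sqnAs sqns.
have sV2 f : sqn (V2 f) = sqn f by rewrite /V2 /= sqnAs sqnr sqns.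
(* [A] is the adjoint of the isometry [As], so |As A f - f|^2 = |f|^2 - |A f|^2. *)
have Ac : contractive A.
  apply/contractive_sqn => f; have := sqn_ge0 (As (A f) - f).
  by rewrite sqnB sqnAs [rdot _ f]/rdot AsA -/(rdot _ _) -/(sqn _); lra.
have W2c : contractive W2.
  apply/contractive_sqn => f; rewrite /W2 /= sqns sqnr.
  exact: (contractive_sqn A).1.
have W1c : contractive W1.
  apply/contractive_sqn => f; rewrite /W1 /= sqns.
  apply: le_trans ((contractive_sqn A).1 Ac _) _.
  by rewrite sqns sqnr sqns.
have W2E f n : W2 f n = sg (rf (P (f n) + (f n.+1 - P (f n.+1)))).
  by rewrite /W2 /= smE rmE AE.
have [d [dE dd]] := l2_single E.
have sqnd n x : sqn (d n x) = sqn x by rewrite /sqn /rdot dd dE eqxx.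
(* The part of [W2 (d n x)] that drops by one slot; nothing lies below slot 0. *)
pose lo n x := if n is k.+1 then d k (sg (rf (x - P x))) else 0.
have W2d n x : W2 (d n x) = d n (sg (rf (P x))) + lo n x.
  apply: l2P => j; transitivity (d n (sg (rf (P x))) j + lo n x j) => //.
  rewrite W2E !dE /lo.
  case: n => [|n] /=.
    rewrite linear0 subr0 addr0 [RHS]addr0.
    by case: eqP => // _; rewrite !linear0.
  rewrite dE eqSS; have [->|jn] := eqVneq j n.
    by rewrite (ltn_eqF (ltnSn n)) linear0 !add0r.
  by rewrite linear0 subr0 !addr0; case: eqP; rewrite // !linear0.
(* W2 is block upper triangular with diagonal blocks sg rf P, whence the
   induction on the position n of a vector supported at n. *)
have stabW2 f : stable W2 f.
  apply: (stable_l2 dE W2c) => n; elim: n => [|n IH] x;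
    apply: (stable_approx W2c) => e e0; have [m hm] := stab x e0; exists m.
    exists 0; split; first exact: stable0.
    suff -> : iter m W2 (d 0%N x) = d 0%N (iter m (sg \o rf \o P) x).
      by rewrite subr0 sqnd.
    by elim: m {hm} => // m IHm; rewrite !iterS IHm W2d addr0.
  suff [g [gs ->]] : exists g, stable W2 g /\
      iter m W2 (d n.+1 x) = d n.+1 (iter m (sg \o rf \o P) x) + g.
    by exists g; split=> //; rewrite addrK sqnd.
  elim: m {hm} => [|m [g [gs IHm]]].
    by exists 0; rewrite addr0; split=> //; exact: stable0.
  rewrite !iterS IHm linearD W2d -addrA; eexists; split; last by [].
  by apply: (stableD W2c); [exact: IH | exact: stable_image].
have stabW1 f : stable W1 f.
  move=> e e0; have [m hm] := stabW2 (sm (rm (sm f))) e e0.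
  (* Up to conjugation by [sm], [W1] is A (sm rm) while [W2] is (sm rm) A: a cyclic permutation of
     factors transfers stability. *)
  exists m.+1; suff -> : iter m.+1 W1 f = sm (A (iter m W2 (sm (rm (sm f))))).
    by rewrite sqns; exact: le_lt_trans ((contractive_sqn A).1 Ac _) hm.
  by elim: m {hm} => // m IHm; rewrite iterS IHm /W1 /W2 /= smK.
exists V1, V2; split.
- split; [ | exact: iso | exact: iso | | ].
  + move=> f; transitivity (Sf f).
      transitivity (sm (rm (sm (As (sm (As (rm (sm f)))))))) => //.
      rewrite AsmAs smK; apply: l2P => -[|n]; rewrite smE rmE !SfE ?linear0//.
      by rewrite rmE smE rfrf sgsg.
    transitivity (As (rm (sm (sm (rm (sm (As (sm f)))))))) => //.
    rewrite smK rmK AsmAs; apply: l2P => -[|n]; rewrite smE !SfE ?linear0//.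
    by rewrite smE sgsg.
  + by apply/(pure_contractionP (isoc _ sV1) W1c V1W1).
  + by apply/(pure_contractionP (isoc _ sV2) W2c V2W2).
- move=> f n; rewrite V1W1 /W1 /= smE AE !smE !rmE !smE.
  by rewrite linearD linearB /= !sgP !sgsg subKr.
- by move=> f n; rewrite V2W2 W2E.
Qed.
End ShiftModel.

(** * Dilation of partial isometries *)

Section PartialIsometry.
Variables (R : realType) (H : hilbertType R).

Lemma contractive_bounded (T : {linear H -> H}) :
  contractive T -> bounded_operator T.
Proof. by move=> Tc; exists 1 => x; rewrite mul1r. Qed.

Lemma adjoint_linear (T : {linear H -> H}) :
  bounded_operator T -> linear (adjoint T).
Proof.
move=> Tb a x y; apply: adjoint_uniq => z.
by rewrite !linearPr /= !(adjointP Tb).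
Qed.

(** The last property says S T S = S, so that T S is a projection. The range of [S] is orthogonal to
    ker T, hence |T S y| = |S y|, and |S y - S T S y|^2 = |S T S y|^2 - |S y|^2 <= 0. *)
Lemma partial_isometry_adjoint (T : {linear H -> H}) :
  contractive T -> partial_isometry T ->
  exists S : {linear H -> H},
    [/\ adjoint T =1 S, forall x y, '[T x, y] = '[x, S y], contractive S &
        forall y, S (y - T (S y)) = 0].
Proof.
move=> Tc [_ Tpi]; have Tb := contractive_bounded Tc.
pose SL := GRing.isLinear.Build R[i] H H *:%R (adjoint T) (adjoint_linear Tb).
pose S : {linear H -> H} := HB.pack (adjoint T) SL.
have TS x y : '[T x, y] = '[x, S y] by exact: adjointP.
have ST x y : '[S x, y] = '[x, T y] by rewrite hdotC -TS -hdotC.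
have Tq := (contractive_sqn T).1 Tc.
have Sq y : sqn (S y) <= sqn y.
  have := sqn_ge0 (T (S y) - y); have := Tq (S y).
  by rewrite sqnB [rdot _ y]/rdot TS -/(rdot _ _) -/(sqn _); lra.
exists S; split=> //; first by apply/contractive_sqn.
move=> y; have TSy : sqn (T (S y)) = sqn (S y).
  have ort k : T k = 0 -> '[S y, k] = 0 by move=> Tk; rewrite ST Tk linear0r.
  by apply: complexI; rewrite -!hdot_sqn !hdot_norm (Tpi _ ort).
apply: sqn_eq0; apply/eqP; rewrite eq_le sqn_ge0 andbT linearB /= sqnB.
have -> : rdot (S y) (S (T (S y))) = sqn (T (S y)) by rewrite /rdot -TS.
by have := Sq (T (S y)); rewrite TSy; lra.
Qed.
(** [D] is 1 - T S; the relation S T S = S makes it the orthogonal projection onto ker S. *)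
Lemma defect_projection (T S : {linear H -> H}) :
  (forall x y, '[T x, y] = '[x, S y]) -> (forall y, S (y - T (S y)) = 0) ->
  exists D : {linear H -> H},
    [/\ forall x, S (D x) = 0, forall x, S x = 0 -> D x = x,
        forall x y, '[D x, D y] = '[x, y] - '[S x, S y] &
        forall x y, '[D x, y - D y] = 0].
Proof.
move=> TS Sker.
have [D DE] : exists D : {linear H -> H}, forall x, D x = x - T (S x).
  by exists (idfun \- (T \o S)).
have SD x : S (D x) = 0 by rewrite DE Sker.
have ST x y : '[x, T y] = '[S x, y] by rewrite hdotC TS -hdotC.
have Ddot x y : '[D x, D y] = '[x, y] - '[S x, S y].
  rewrite [in '[D x, _]]DE linearBl /= TS SD linear0r subr0.
  by rewrite DE linearBr /= ST.
exists D; split=> // [x Sx|x y]; first by rewrite DE Sx linear0 subr0.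
by rewrite linearBr /= Ddot DE linearBl /= TS subrr.
Qed.

End PartialIsometry.

(** * Dilation of the pair, in terms of the adjoints and defect projections *)

Section Dilation.
Variables (R : realType) (H : hilbertType R) (S1 S2 D1 D2 : {linear H -> H}).
Hypothesis S1c : contractive S1.
Hypothesis S2c : contractive S2.
Hypothesis S12 : forall x, S1 (S2 x) = S2 (S1 x).
Hypothesis st1 : forall x, stable S1 x.
Hypothesis st2 : forall x, stable S2 x.
Hypothesis S1D : forall x, S1 (D1 x) = 0.
Hypothesis S2D : forall x, S2 (D2 x) = 0.
Hypothesis D1id : forall x, S1 x = 0 -> D1 x = x.
Hypothesis D2id : forall x, S2 x = 0 -> D2 x = x.
Hypothesis D1dot : forall x y, '[D1 x, D1 y] = '[x, y] - '[S1 x, S1 y].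
Hypothesis D2dot : forall x y, '[D2 x, D2 y] = '[x, y] - '[S2 x, S2 y].
Hypothesis D1perp : forall x y, '[D1 x, y - D1 y] = 0.
Hypothesis D2perp : forall x y, '[D2 x, y - D2 y] = 0.

(** The coefficient space E is [l2 H]. Slots 0 and 3 hold the two components of Ando's vectors,
    slots 1 and 2 their swapped copies, and [sg \o rf] is the unitary sending (D1 h, D2 S1 h) to (D1
    S2 h, D2 h). *)
Lemma pure_isometric_dilation :
  exists (V1 V2 : {linear l2 (l2 H) -> l2 (l2 H)})
         (Pi : {linear H -> l2 (l2 H)}),
    [/\ commuting_pure_isometries V1 V2, isometric Pi,
        forall h, Pi (S1 h) = adjoint V1 (Pi h) &
        forall h, Pi (S2 h) = adjoint V2 (Pi h)].
Proof.
have [d [dE dd]] := l2_single H.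
have [P [PE PP Ps]] := l2_even H.
have [sg [sgE sgsg sgs]] := l2_swap H.
have Pd n x : P (d n x) = if odd n then 0 else d n x.
  apply: l2P => k; rewrite PE dE; have [->|kn] := eqVneq k n.
    by case: ifP => //; rewrite dE eqxx.
  by rewrite if_same; case: ifP => //; rewrite dE (negbTE kn).
have sgd n x : sg (d n x) = d (pair_swap n) x.
  by apply: l2P => k; rewrite sgE !dE (can2_eq pair_swapK pair_swapK).
have sgP x : sg (P x) = sg x - P (sg x).
  apply: l2P => k; transitivity (sg x k - P (sg x) k) => //.
  rewrite !PE !sgE PE /pair_swap.
  case: (boolP (odd k)) => ko /=; last by rewrite ko subrr.
  by case: k ko => //= k /negbTE ->; rewrite subr0.
(* J h is Ando's vector (D1 h, D2 T1^* h) in slots 0, 3 and J' h is the vector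
   (D1 T2^* h, D2 h) in slots 1, 2, where S_i = T_i^*.  As J and J' induce the
   same form, J h - J' h is orthogonal to all J k + J' k, so that the reflection
   rf exchanges J h and J' h. *)
pose J h := d 0%N (D1 h) + d 3 (D2 (S1 h)).
pose J' h := d 1%N (D1 (S2 h)) + d 2 (D2 h).
have [rf [rfrf rfs rf1 rfN]] :=
  orthc_reflection [set J h + J' h | h in [set: H]].
have l2D (f g : l2 H) n : (f + g) n = f n + g n by [].
have l2B (f g : l2 H) n : (f - g) n = f n - g n by [].
have JE h n : J h n = nth 0 [:: D1 h; 0; 0; D2 (S1 h)] n.
  rewrite l2D !dE.
  by case: n => [|[|[|[|n]]]]; rewrite /= ?addr0 ?add0r ?nth_nil.
have J'E h n : J' h n = nth 0 [:: 0; D1 (S2 h); D2 h; 0] n.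
  rewrite l2D !dE.
  by case: n => [|[|[|[|n]]]]; rewrite /= ?addr0 ?add0r ?nth_nil.
have Jdot h f : '[J h, f] = '[D1 h, f 0%N] + '[D2 (S1 h), f 3].
  by rewrite linearDl /= !dd.
have J'dot h f : '[J' h, f] = '[D1 (S2 h), f 1%N] + '[D2 h, f 2].
  by rewrite linearDl /= !dd.
have rfJ h : rf (J h) = J' h.
  have e1 : rf (J h) + rf (J' h) = J h + J' h.
    by rewrite -linearD rf1//; exists h.
  have e2 : rf (J h) - rf (J' h) = J' h - J h.
    rewrite -linearB rfN ?opprB// => _ [k _ <-].
    rewrite linearDl linearBr /= linearBr /= !Jdot !J'dot !JE !J'E /=.
    by rewrite !linear0r !D1dot !D2dot !S12; ring.
  have : 2 *: rf (J h) = 2 *: J' h :> l2 H.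
    rewrite !scaler_nat !mulr2n.
    transitivity (rf (J h) + rf (J' h) + (rf (J h) - rf (J' h))).
      by rewrite addrACA subrr addr0.
    by rewrite e1 e2 (addrC (J h)) addrACA subrr addr0.
  by apply: scalerI; rewrite pnatr_eq0.
have rfJ' h : rf (J' h) = J h by rewrite -rfJ rfrf.
have sgJ' h : sg (J' h) = d 0%N (D1 (S2 h)) + d 3 (D2 h).
  by rewrite linearD /= !sgd.
(* As [S1] kills the range of [D1], the vector [J (D1 x)] sits in slot 0 alone; as [S2] preserves
   ker S1, [D1] acts trivially on [S2 (D1 x)]. The next fact is symmetric. *)
have rf0 x : rf (d 0%N (D1 x)) = d 1%N (S2 (D1 x)) + d 2 (D2 (D1 x)).
  have Jx : J (D1 x) = d 0%N (D1 x) by rewrite /J S1D !linear0 addr0 D1id.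
  by rewrite -Jx rfJ /J' [in D1 (S2 _)]D1id// S12 S1D linear0.
have rf2 x : rf (d 2 (D2 x)) = d 0%N (D1 (D2 x)) + d 3 (S1 (D2 x)).
  have Jx : J' (D2 x) = d 2 (D2 x) by rewrite /J' S2D !linear0 add0r D2id.
  by rewrite -Jx rfJ' /J [in D2 (S1 _)]D2id// -S12 S2D linear0.
have sqnd n x : sqn (d n x) = sqn x by rewrite /sqn /rdot dd dE eqxx.
(* The range of D1 is invariant under T2^*, and that of D2 under T1^*: the
   compression of sg rf to the range of P is T2^* D1 + T1^* D2. *)
have PsrP x : P (sg (rf (P x))) = d 0%N (S2 (D1 (x 0%N))) + d 2 (S1 (D2 (x 2))).
  (* The rest [r] is orthogonal to every [J k + J' k], so [rf] negates it; it lives in even slots,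
     so [sg r] is killed by [P]. *)
  pose r := P x - (d 0%N (D1 (x 0%N)) + d 2 (D2 (x 2))).
  have rfr : rf r = - r.
    apply: rfN => _ [k _ <-].
    rewrite linearDl /= Jdot J'dot !l2B !l2D !PE !dE /=.
    rewrite !addr0 !add0r !oppr0 !linear0r D1perp.
    by rewrite D2perp !addr0.
  have Px : P x = d 0%N (D1 (x 0%N)) + d 2 (D2 (x 2)) + r.
    by rewrite addrC subrK.
  have Psr : P (sg r) = 0.
    apply: l2P => k; rewrite PE sgE /pair_swap; case: (boolP (odd k)) => // ko.
    rewrite l2B l2D PE !dE /= ko.
    case: eqP => [[k1]|_]; first by rewrite k1 in ko.
    by rewrite addr0 subr0.
  clearbody r; rewrite Px !linearD /= rfr rf0 rf2 !linearD !linearN /=.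
  by rewrite !sgd !Pd /= Psr !addr0 add0r subr0.
have stab x : stable (sg \o rf \o P) x.
  pose C := sg \o rf \o P.
  (* These iterates remain in ker S1 and ker S2, where [D1] and [D2] are the identity, so the
     compression acts on them as [S2] and [S1]. *)
  pose a m := iter m S2 (D1 (x 0%N)); pose b m := iter m S1 (D2 (x 2)).
  have Sa m : S1 (a m) = 0.
    by elim: m => [|m IH] /=; rewrite ?S1D// S12 IH linear0.
  have Sb m : S2 (b m) = 0.
    by elim: m => [|m IH] /=; rewrite ?S2D// -S12 IH linear0.
  have CE m : P (iter m.+1 C x) = d 0%N (a m.+1) + d 2 (b m.+1).
    elim: m => [|m IH]; first exact: PsrP.
    rewrite -[LHS]/(P (sg (rf (P (iter m.+1 C x))))) PsrP.
    have z0 : (iter m.+1 C x) 0%N = a m.+1.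
      by rewrite -[LHS](PE _ 0%N) IH l2D !dE /= addr0.
    have z2 : (iter m.+1 C x) 2 = b m.+1.
      by rewrite -[LHS](PE _ 2) IH l2D !dE /= add0r.
    by rewrite z0 z2 D1id// D2id.
  move=> e e0; have e4 : 0 < e / 4 by rewrite divr_gt0.
  have [m1 hm1] := st2 (D1 (x 0%N)) e4; have [m2 hm2] := st1 (D2 (x 2)) e4.
  (* [CE] controls an iterate only after [P]; one more application of [C] applies that [P], followed
     by the norm-preserving [sg] and [rf]. *)
  exists (m1 + m2).+2.
  rewrite -[iter _ _ _]/(sg (rf (P (iter (m1 + m2).+1 C x)))).
  rewrite (selfadjoint_involution_sqn sgsg sgs).
  rewrite (selfadjoint_involution_sqn rfrf rfs) CE.
  apply: le_lt_trans (sqnD_le _ _) _; rewrite !sqnd.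
  have : sqn (a (m1 + m2).+1) <= sqn (a m1).
    by rewrite /a -addnS addnC iterD; exact: sqn_iter_le.
  have : sqn (b (m1 + m2).+1) <= sqn (b m2).
    by rewrite /b -addSn iterD; exact: sqn_iter_le.
  by rewrite /a /b; lra.
have [V1 [V2 [V12 V1E V2E]]] := shift_model PP Ps sgsg sgs rfrf rfs sgP stab.
have QE h n : iter n (S1 \o S2) h = iter n S1 (iter n S2 h).
  elim: n h => //= n IH h; rewrite IH; congr (S1 _).
  by elim: n (iter n S2 h) {IH} => //= n IH y; rewrite -IH S12.
(* v h = sg (J' h), and Pi h is the sequence of the v ((T1 T2)^*n h). *)
pose v : {linear H -> l2 H} := (d 0%N \o D1 \o S2) \+ (d 3 \o D2).
have vE h : v h = d 0%N (D1 (S2 h)) + d 3 (D2 h) by [].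
(* The defect of [S1] at [S2 h] and that of [S2] at [h] telescope; summing over the iterates of [Q],
   which tend to 0, makes [Pi] isometric. *)
have sqnv h : sqn (v h) = sqn h - sqn (S1 (S2 h)).
  apply: complexI; rewrite -[LHS]hdot_sqn vE rmorphB /= -!hdot_sqn.
  by rewrite linearDl /= !dd !l2D !dE /= addr0 add0r D1dot D2dot; ring.
pose Q : {linear H -> H} := S1 \o S2.
have Qc : contractive Q by move=> x; exact: le_trans (S1c _) (S2c _).
have sumv h n :
    \sum_(0 <= k < n) sqn (v (iter k Q h)) = sqn h - sqn (iter n Q h).
  elim: n => [|n IH]; first by rewrite big_nil subrr.
  by rewrite big_nat_recr//= IH sqnv; ring.
have iterQ a x y n : iter n Q (a *: x + y) = a *: iter n Q x + iter n Q y.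
  by elim: n => [//|n IH]; rewrite !iterS IH linearP.
have [Pi PiE] : exists Pi : {linear H -> l2 (l2 H)},
    forall h n, Pi h n = v (iter n Q h).
  apply: (@l2_linear _ _ _ (fun h n => v (iter n Q h))) => [a x y k|h].
    by rewrite iterQ linearP.
  by exists (sqn h) => n; rewrite sumv gerBl sqn_ge0.
have stQ h : stable Q h.
  move=> e e0; have [m hm] := st2 h e0; exists m.
  by rewrite QE; apply: le_lt_trans hm; exact: sqn_iter_le.
have QS1 x : Q (S1 x) = S1 (Q x) by rewrite /Q /= -S12.
have QS2 x : Q (S2 x) = S2 (Q x) by rewrite /Q /= S12.
have iterQS1 n h : iter n Q (S1 h) = S1 (iter n Q h).
  by elim: n => // n IH; rewrite !iterS IH QS1.
have iterQS2 n h : iter n Q (S2 h) = S2 (iter n Q h).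
  by elim: n => // n IH; rewrite !iterS IH QS2.
have rfsgv k : rf (sg (v k)) = J k by rewrite vE -sgJ' sgsg rfJ'.
have PJ k : P (J k) = d 0%N (D1 k) by rewrite linearD /= !Pd addr0.
have Pv k : P (v k) = d 0%N (D1 (S2 k)) by rewrite vE linearD /= !Pd addr0.
exists V1, V2, Pi; split=> //.
- move=> h; rewrite !norm_sqn; congr ((Num.sqrt _)%:C).
  rewrite /sqn rdot_l2; apply: l2_rdotE; apply/cvgrPdist_lt => e e0.
  have [m hm] := stQ h e e0; exists m => // n /= mn.
  under eq_bigr do rewrite PiE.
  rewrite sumv opprB addrC subrK ger0_norm ?sqn_ge0//.
  by apply: le_lt_trans hm; rewrite -(subnK mn) iterD; exact: sqn_iter_le.
(* Here g n = J k and g (n+1) = J (Q k): slot 3 of the former and slot 0 of the latter make up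
   [v (S1 k)]. *)
- move=> h; apply: l2P => n; rewrite V1E /= !PiE iterQS1 iterS.
  move: (iter n Q h) => k.
  rewrite !rfsgv PJ PJ /J [X in X + _]addrAC subrr add0r vE.
  by rewrite addrC /Q /= S12.
(* Slot 0 of [v k] and slot 3 of [v (Q k)] form [J (S2 k)], which [sg \o rf] sends to [v (S2 k)]. *)
- move=> h; apply: l2P => n; rewrite V2E !PiE iterQS2 iterS.
  move: (iter n Q h) => k.
  rewrite !Pv [v (Q k)]vE [d 0%N _ + _ - _]addrAC subrr add0r.
  by rewrite -[_ + _]/(J (S2 k)) rfJ sgJ'.
Qed.
End Dilation.

Theorem theorem5p3 (R : realType) (H : hilbertType R)
    (T1 T2 : {linear H -> H})
    (hT : commuting_pure_partial_isometries T1 T2) :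
  exists (K : hilbertType R) (V1 V2 : {linear K -> K}),
    commuting_pure_isometries V1 V2 /\ dilates_to T1 T2 V1 V2.
Proof.
have [T12 pi1 pi2 p1 p2] := hT.
have [S1 [adj1 TS1 S1c S1ker]] := partial_isometry_adjoint p1.1 pi1.
have [S2 [adj2 TS2 S2c S2ker]] := partial_isometry_adjoint p2.1 pi2.
have st1 := (pure_contractionP p1.1 S1c adj1).1 p1.
have st2 := (pure_contractionP p2.1 S2c adj2).1 p2.
have S12 x : S1 (S2 x) = S2 (S1 x).
  apply/eqP; rewrite -subr_eq0 -normr_eq0 -sqrf_eq0 -hdot_norm.
  by rewrite linearBr /= -!TS1 -!TS2 -!TS1 T12 subrr.
have [D1 [S1D D1id D1dot D1perp]] := defect_projection TS1 S1ker.
have [D2 [S2D D2id D2dot D2perp]] := defect_projection TS2 S2ker.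
have [V1 [V2 [Pi [V12 Pi_iso PiS1 PiS2]]]] := pure_isometric_dilation
  S1c S2c S12 st1 st2 S1D S2D D1id D2id D1dot D2dot D1perp D2perp.
exists (l2 (l2 H)), V1, V2; split=> //.
by exists Pi; split=> [//|h|h]; [rewrite adj1 PiS1 | rewrite adj2 PiS2].
Qed.
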